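(* Let $k\ge1$ be an integer, let $\beta$ be real with $\delta:=\beta-(k-1)<0$, let $0<\alpha:=y/x<1$, and let $\varepsilon>0$ be arbitrarily small. Then there exists a positive constant $q_k$ such that $$\phi_{\Phi_k,\beta}(x,y)\ll_\delta x^{\frac12+(1-\delta)\varepsilon}\,y^{\frac{1}{2(1-\delta)}-\varepsilon}\exp\left(-\sqrt{q_k\log x\log\log x}\right)$$ for all $x\ge x_{\beta,k}$, where $x_{\beta,k}$ is a sufficiently large real number depending on $\beta$ and $k$.
   Context: For an integer $k\ge1$ and $n\in\mathbb{N}$, $\Phi_k(n)=|\{(x_1,\dots,x_k)\in(\mathbb{Z}/n\mathbb{Z})^k:\gcd(x_1^2+\cdots+x_k^2,n)=1\}|$. For real $\beta$ and $x,y>0$, $\phi_{\Phi_k,\beta}(x,y)=|\{n\le x:\Phi_k(n)/n^{\beta}\le y\}|$. The notation $\ll_\delta$ means the implied constant may depend on $\delta$. *)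

(* Defs.v *)
From HB Require Import structures.
From mathcomp Require Import all_boot all_order all_algebra.
From mathcomp Require Import reals exp.

Set Implicit Arguments.
Unset Strict Implicit.
Unset Printing Implicit Defensive.

Import Order.TTheory GRing.Theory Num.Theory.
Local Open Scope ring_scope.

(* For n >= 1, residue classes modulo n are represented by 'I_n = {0, ..., n-1}
   ('Z_n would be wrong for n = 1); coprimality with n does not depend on the
   choice of representatives. *)
Definition Phi (k n : nat) : nat :=
  #|[set x : {ffun 'I_k -> 'I_n} | coprime (\sum_(i < k) x i ^ 2) n]|%N.

(* The number of integers 1 <= n <= x with f n / n ^ beta <= y: for an integer
   n >= 1, n <= x is the same as n <= Num.truncn x. *)
Definition phi_count (R : realType) (f : nat -> R) (beta x y : R) : nat :=
  #|[set n : 'I_(Num.truncn x).+1 | (0 < n)%N & f n / n%:R `^ beta <= y]|.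

(* Main.v *)
(* Fixing x_2, ..., x_k, the values x_1^2 + a avoid 0 modulo p for at least p/3
   of the residues x_1, whatever the prime p; lifting one prime at a time gives
   n^k <= 3^omega(n) Phi_k(n).  As 3^omega(n) is O(n^eta) for every eta > 0, the
   choice eta = -delta/2 turns Phi_k(n) / n^beta <= y into
   n <= (A y)^(1/(1 - delta/2)), which bounds the count.  Since y < x, this beats
   x^(1/2) y^(1/(2(1-delta))) by a power of x, namely x^(saving delta), and
   sqrt(log x log log x) <= (saving delta) log x for large x.  The factor
   x^((1-delta) eps) y^(-eps) is at least 1. *)
Require Import Defs.
From HB Require Import structures.
From mathcomp Require Import all_boot all_order all_algebra.
From mathcomp Require Import reals sequences exp.
From mathcomp Require Import zify ring lra.

Set Implicit Arguments.
Unset Strict Implicit.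
Unset Printing Implicit Defensive.

Import Order.TTheory GRing.Theory Num.Theory.
Local Open Scope ring_scope.

(** * Coprime values of sums of squares modulo [n] *)

Section CoprimeValues.
Local Open Scope nat_scope.

(** Each such [j] gives a root [i + j * m] of [X^2 + a] over ['F_p]; as [m] is invertible there,
    distinct [j] give distinct roots. *)
Lemma card_quadratic_roots_mod (p m i a : nat) : prime p -> coprime p m ->
  #|[set j : 'I_p | p %| (i + j * m) ^ 2 + a]| <= 2.
Proof.
move=> p_pr co_pm; set B := [set j : 'I_p | _].
have chp : p \in [pchar 'F_p] by apply: pchar_Fp.
pose P : {poly 'F_p} := ('X^2 + (a%:R)%:P)%R.
pose rs := [seq (((i + j * m)%N)%:R : 'F_p)%R | j : 'I_p <- enum B].
have szP : size P = 3 by rewrite size_XnaddC.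
have -> : #|B| = size rs by rewrite size_map -cardE.
rewrite -ltnS -szP; apply: max_poly_roots.
- by rewrite -size_poly_eq0 szP.
- apply/allP => z /mapP[j]; rewrite mem_enum inE => jB ->.
  by rewrite /root !hornerE -natrX -natrD -(dvdn_pcharf chp).
- rewrite map_inj_uniq ?enum_uniq // => j j' /eqP.
  rewrite !natrD !natrM (inj_eq (addrI _)) -subr_eq0 -mulrBl mulf_eq0.
  have /negbTE-> : (m%:R : 'F_p)%R != 0%R.
    by rewrite -(dvdn_pcharf chp) -prime_coprime.
  rewrite orbF subr_eq0 => /eqP/(congr1 (@nat_of_ord _)).
  by rewrite !val_Fp_nat // !modn_small // => /val_inj.
Qed.

Lemma leq_sum_coprime_lifts (p m i a : nat) : prime p -> coprime p m ->
  p <= 3 * \sum_(0 <= j < p) coprime ((i + j * m) ^ 2 + a) p.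
Proof.
move=> p_pr co_pm.
have coE x : coprime x p = ~~ (p %| x) by rewrite coprime_sym prime_coprime.
(* Two bad residues could exhaust [p = 2]. There [m] is odd, so the two lifts have opposite parities
   and exactly one is good. For [p >= 3], [p - 2 >= p / 3]. *)
have [p2|p_neq2] := eqVneq p 2.
  have odd_m : odd m by move: co_pm; rewrite p2 coprime2n.
  rewrite p2 big_nat_recr //= big_nat1 !coprimen2 !mul0n !mul1n addn0.
  rewrite !oddD !oddX !oddD odd_m /=.
  by case: (odd i) (odd a) => -[].
have p_gt2 : 2 < p by rewrite ltn_neqAle eq_sym p_neq2 prime_gt1.
rewrite big_mkord (eq_bigr _ (fun j _ => congr1 nat_of_bool (coE _))).
rewrite -big_mkcond sum1dep_card.
set B := [set j : 'I_p | p %| (i + j * m) ^ 2 + a].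
have -> : [set j : 'I_p | ~~ (p %| (i + j * m) ^ 2 + a)] = ~: B.
  by apply/setP => j; rewrite !inE.
have := cardsC B; rewrite card_ord.
have : #|B| <= 2 := card_quadratic_roots_mod i a p_pr co_pm.
lia.
Qed.

Definition coprime_values (a n : nat) :=
  \sum_(0 <= x < n) coprime (x ^ 2 + a) n.

Lemma coprime_sqrD_lift (i j m a : nat) :
  coprime ((i + j * m) ^ 2 + a) m = coprime (i ^ 2 + a) m.
Proof.
rewrite -coprime_modl -modnDml -modnXm [(i + _)%N]addnC modnMDl.
by rewrite modnXm modnDml coprime_modl.
Qed.

(** Residues modulo [p * m] are written [i + j * m], and coprimality to [m] depends on [i] only.
    This serves both for a new prime [p] and for one dividing [m]. *)
Lemma coprime_valuesM (a p m : nat) :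
  coprime_values a (p * m) = \sum_(0 <= i < m)
    coprime (i ^ 2 + a) m * \sum_(0 <= j < p) coprime ((i + j * m) ^ 2 + a) p.
Proof.
rewrite /coprime_values big_nat_mul.
under eq_bigr => j _ do
  rewrite -{1}[(j * m)%N]add0n big_addn mulSn addnK.
rewrite exchange_big /=; apply: eq_bigr => i _.
rewrite big_distrr /=; apply: eq_bigr => j _.
by rewrite coprimeMr coprime_sqrD_lift mulnb andbC.
Qed.

(** Induction on [n = p * m], with [p] the least prime factor: a new prime costs a factor 3, a
    repeated one nothing. *)
Lemma leq_coprime_values (a n : nat) : 0 < n ->
  n <= coprime_values a n * 3 ^ size (primes n).
Proof.
elim/ltn_ind: n => n IH n_gt0.
have [n1|n_neq1] := eqVneq n 1.
  by rewrite n1 /coprime_values big_nat1 coprimen1.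
have n_gt1 : 1 < n by lia.
set p := pdiv n; have p_pr : prime p := pdiv_prime n_gt1.
have p_gt1 := prime_gt1 p_pr.
have [m def_n] := dvdnP (pdiv_dvd n).
rewrite -/p mulnC in def_n.
have m_gt0 : 0 < m by move: n_gt0; rewrite def_n muln_gt0 => /andP[].
have lt_mn : m < n by rewrite def_n -{1}[m]mul1n ltn_pmul2r.
have leIH := IH m lt_mn m_gt0.
rewrite {1}def_n; apply: leq_trans (leq_mul (leqnn p) leIH) _.
have [co_pm|] := boolP (coprime p m).
  have -> : size (primes n) = (size (primes m)).+1.
    suff /perm_size-> : perm_eq (primes n) (p :: primes m) by [].
    apply: uniq_perm; rewrite /= ?primes_uniq ?andbT //.
      by rewrite mem_primes p_pr m_gt0 /= -prime_coprime.
    by move=> q; rewrite def_n primesM ?(ltnW p_gt1) // primes_prime // !inE.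
  rewrite expnS [X in _ <= X]mulnA mulnA leq_mul2r; apply/orP; right.
  rewrite def_n coprime_valuesM /coprime_values big_distrr big_distrl /=.
  apply: leq_sum => i _.
  by rewrite mulnC -mulnA leq_mul2l mulnC leq_sum_coprime_lifts ?orbT // mulnC.
(* Now a value coprime to [m] is already coprime to [p], so all [p] lifts survive, and [n] has the
   same primes as [m]. *)
rewrite prime_coprime // negbK => p_dv_m.
have -> : primes n = primes m.
  apply/eq_primes => q.
  rewrite def_n primesM ?(ltnW p_gt1) // primes_prime // inE orb_idl //.
  by move=> /eqP->; rewrite mem_primes p_pr m_gt0.
rewrite mulnA leq_mul2r; apply/orP; right.
rewrite def_n coprime_valuesM /coprime_values big_distrr /=.
apply: leq_sum => i _.
have [co_im|_] := boolP (coprime (i ^ 2 + a) m); last by rewrite muln0.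
rewrite muln1 mul1n (eq_bigr (fun=> 1)) => [|j _].
  by rewrite sum_nat_const_nat subn0 muln1.
by rewrite (coprime_dvdr p_dv_m) // coprime_sqrD_lift.
Qed.

(** With the last [k] coordinates fixed, the sum of their squares acts as the shift [a] for
    coordinate [ord0]; [h] glues the two pieces together. *)
Lemma leq_Phi (k n : nat) : 0 < n ->
  n ^ k.+1 <= Phi k.+1 n * 3 ^ size (primes n).
Proof.
move=> n_gt0.
pose h (u : {ffun 'I_k -> 'I_n} * 'I_n) : {ffun 'I_k.+1 -> 'I_n} :=
  [ffun i => if unlift ord0 i is Some j then u.1 j else u.2].
have h_inj : injective h.
  move=> [g x] [g' x'] /ffunP hh; congr pair.
    apply/ffunP => j; have := hh (lift ord0 j).
    by rewrite !ffunE liftK.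
  by have := hh ord0; rewrite !ffunE unlift_none.
pose A := [set u : {ffun 'I_k -> 'I_n} * 'I_n |
  coprime (u.2 ^ 2 + \sum_(i < k) u.1 i ^ 2) n].
have leA : #|A| <= Phi k.+1 n.
  rewrite -(card_imset A h_inj); apply/subset_leq_card/subsetP => f /imsetP[u].
  rewrite !inE big_ord_recl => uA ->.
  by rewrite !ffunE unlift_none; under eq_bigr => i _ do rewrite ffunE liftK.
apply: leq_trans (leq_mul leA (leqnn _)).
have -> : #|A| = \sum_(g : {ffun 'I_k -> 'I_n})
    coprime_values (\sum_(i < k) g i ^ 2) n.
  rewrite -sum1_card big_mkcond /=.
  under [RHS]eq_bigr => g _ do rewrite /coprime_values big_mkord.
  by rewrite pair_bigA /=; apply: eq_bigr => u _; rewrite inE; case: coprime.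
rewrite big_distrl /= expnSr.
have -> : n ^ k = \sum_(g : {ffun 'I_k -> 'I_n}) 1.
  by rewrite sum1_card card_ffun !card_ord.
rewrite big_distrl /=; apply: leq_sum => g _.
by rewrite mul1n leq_coprime_values.
Qed.

Lemma leq_prod_primes (n : nat) : 0 < n -> \prod_(p <- primes n) p <= n.
Proof.
move=> n_gt0; rewrite {2}(prod_prime_decomp n_gt0) /primes /unzip1 big_map.
rewrite !big_seq; apply: leq_prod => -[p e] /mem_prime_decomp[p_pr e_gt0 _] /=.
by rewrite -{1}[p]expn1 leq_pexp2l ?(prime_gt0 p_pr).
Qed.

End CoprimeValues.

(* A prime above [3 `^ eta^-1] pays for its factor 3 with its own [eta]-th power;
   the others are counted separately. *)
Lemma expr_size_le (R : realType) (eta : R) (s : seq nat) :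
  0 < eta -> all (leq 1) s ->
  3 ^+ size s <= 3 ^+ count (geq (Num.truncn (3 `^ eta^-1 : R))) s
    * (\prod_(p <- s) p)%N%:R `^ eta :> R.
Proof.
move=> eta_gt0; set T := Num.truncn _.
elim: s => [|p s IH] /=; first by rewrite big_nil expr0 powR1 mulr1.
move=> /andP[p_gt0 /IH{}IH].
rewrite big_cons natrM powRM // exprS exprD mulrACA.
apply: ler_pM => //; first exact: exprn_ge0.
have p_ge1 : 1 <= p%:R :> R by rewrite ler1n.
case: (leqP p T) => [_|ltTp] /=.
  rewrite expr1 ler_peMr //; apply: le_trans (ler_powR p_ge1 (ltW eta_gt0)).
  by rewrite powRr0.
rewrite expr0 mul1r.
have -> : 3 = (3 `^ eta^-1) `^ eta :> R.
  by rewrite -powRrM mulVf ?gt_eqF // powRr1.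
apply: ge0_ler_powR; rewrite ?nnegrE ?powR_ge0 ?(ltW eta_gt0) //.
by rewrite ltW // -truncn_lt_nat ?powR_ge0.
Qed.

(** The exponent crudely bounds the number of primes up to the threshold: they lie among
    [0, ..., T]. *)
Definition omega_const (R : realType) (eta : R) : R :=
  3 ^+ (Num.truncn (3 `^ eta^-1 : R)).+1.

Lemma omega_const_gt0 (R : realType) (eta : R) : 0 < omega_const eta.
Proof. exact: exprn_gt0. Qed.

Lemma expr_size_primes_le (R : realType) (eta : R) (n : nat) :
  0 < eta -> (0 < n)%N ->
  3 ^+ size (primes n) <= omega_const eta * n%:R `^ eta :> R.
Proof.
move=> eta_gt0 n_gt0.
have all_gt0 : all (leq 1) (primes n).
  by apply/allP => p; rewrite mem_primes => /andP[/prime_gt0].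
apply: le_trans (expr_size_le eta_gt0 all_gt0) _.
apply: ler_pM; rewrite ?exprn_ge0 ?powR_ge0 //.
  rewrite ler_weXn2l ?ler1n // -size_filter.
  set T := Num.truncn _.
  rewrite -[T.+1](size_iota 0); apply: uniq_leq_size.
    by rewrite filter_uniq ?primes_uniq.
  by move=> p; rewrite mem_filter mem_iota => /andP[].
apply: ge0_ler_powR; rewrite ?nnegrE ?(ltW eta_gt0) //.
by rewrite ler_nat leq_prod_primes.
Qed.

Lemma powR_le_Phi (R : realType) (eta : R) (k n : nat) :
  0 < eta -> (0 < k)%N -> (0 < n)%N ->
  n%:R `^ (k%:R - eta) <= omega_const eta * (Phi k n)%:R.
Proof.
case: k => // k eta_gt0 _ n_gt0.
have n_neq0 : n%:R != 0 :> R by rewrite pnatr_eq0 -lt0n.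
have pow_gt0 : 0 < n%:R `^ eta :> R by rewrite powR_gt0 // ltr0n.
rewrite powRB ?n_neq0 ?implybT // powR_mulrn //.
rewrite ler_pdivrMr //.
have := leq_Phi k n_gt0; rewrite -(ler_nat R) natrM !natrX => /le_trans; apply.
rewrite mulrC mulrAC ler_wpM2r //.
exact: expr_size_primes_le.
Qed.

(** * From the lower bound on [Phi] to the counting function *)

Lemma phi_count_le (R : realType) (f : nat -> R) (beta x y Z : R) :
  0 <= Z ->
  (forall n : nat, (0 < n)%N -> f n / n%:R `^ beta <= y -> n%:R <= Z) ->
  (phi_count f beta x y)%:R <= Z.
Proof.
move=> Z_ge0 fZ; rewrite -truncn_ge_nat // /phi_count.
set A := [set n | _]; set T := Num.truncn Z.
(* Starting at 1 excludes [n = 0], so the bound is [T] rather than [T.+1]. *)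
rewrite cardE -(size_map (@nat_of_ord _)) -[T](size_iota 1).
apply: uniq_leq_size; first by rewrite (map_inj_uniq val_inj) enum_uniq.
move=> m /mapP[n]; rewrite mem_enum inE => /andP[n_gt0 leny] ->.
by rewrite mem_iota add1n ltnS n_gt0 truncn_ge_nat // fZ.
Qed.

(** Write [u] as the square of [s = Num.sqrt u] and use [ln s <= s - 1]. *)
Lemma ln_le_sqrt (R : realType) (u : R) : 0 < u -> ln u <= 2 * Num.sqrt u.
Proof.
move=> u_gt0; have s_gt0 : 0 < Num.sqrt u by rewrite sqrtr_gt0.
rewrite -{1}(sqr_sqrtr (ltW u_gt0)) lnXn // mulr2n.
have := @le_ln1Dx R (Num.sqrt u - 1).
by rewrite [1 + _]addrC subrK => /(_ ltac:(lra)); lra.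
Qed.

Lemma sqrt_mulr_ln_le (R : realType) (g u : R) : 0 < g -> 0 < u ->
  4 / g ^+ 4 <= u -> Num.sqrt (u * ln u) <= g * u.
Proof.
move=> g_gt0 u_gt0 leu.
rewrite -[leRHS]gtr0_norm ?mulr_gt0 // -sqrtr_sqr ler_sqrt ?sqr_ge0 //.
have g4 : 0 < g ^+ 4 by rewrite exprn_gt0.
have : ln u <= g ^+ 2 * u.
  apply: le_trans (ln_le_sqrt u_gt0) _.
  have s_gt0 : 0 < Num.sqrt u by rewrite sqrtr_gt0.
  have su : u = Num.sqrt u ^+ 2 by rewrite sqr_sqrtr // ltW.
  (* Squared, this is the threshold [4 / g ^+ 4 <= u]. *)
  have le2 : 2 <= g ^+ 2 * Num.sqrt u.
    rewrite -(@ler_pXn2r _ 2) ?nnegrE ?(mulr_ge0 (sqr_ge0 g) (sqrtr_ge0 u)) //.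
    rewrite exprMn -su -exprM /= mulrC.
    by move: leu; rewrite ler_pdivrMr //; lra.
  apply: le_trans (_ : g ^+ 2 * Num.sqrt u * Num.sqrt u <= _).
    by rewrite ler_pM2r.
  by rewrite {3}su expr2 [leRHS]mulrA.
rewrite exprMn; nra.
Qed.

(** The first term is [1/2 + 1/(2(1-delta))], the total exponent of the target at [y = x]; the
    second is the exponent in the bound on [n]. *)
Definition saving (R : realType) (delta : R) : R :=
  (1 - delta / 2) / (1 - delta) - (1 - delta / 2)^-1.

(** Clearing denominators leaves [(1 - delta/2)^2 > 1 - delta], with difference [delta^2/4]. *)
Lemma saving_gt0 (R : realType) (delta : R) : delta < 0 -> 0 < saving delta.
Proof.
move=> d_lt0; have D_gt0 : 0 < 1 - delta by lra.
have D'_gt0 : 0 < 1 - delta / 2 by lra.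
rewrite subr_gt0 ltr_pdivlMr // mulrC ltr_pdivrMr //; nra.
Qed.

Lemma size_le_of_Phi_le (R : realType) (k n : nat) (beta y : R) :
  let delta := beta - (k%:R - 1) in
  delta < 0 -> (0 < k)%N -> (0 < n)%N -> (Phi k n)%:R / n%:R `^ beta <= y ->
  n%:R <= (omega_const (- delta / 2) * y) `^ (1 - delta / 2)^-1.
Proof.
move=> delta d_lt0 k_gt0 n_gt0 leny.
have D'_gt0 : 0 < 1 - delta / 2 by lra.
have n_neq0 : n%:R != 0 :> R by rewrite pnatr_eq0 -lt0n.
have nb_gt0 : 0 < n%:R `^ beta :> R by rewrite powR_gt0 // ltr0n.
have eta_gt0 : 0 < - delta / 2 by lra.
have leA : n%:R `^ (1 - delta / 2) <= omega_const (- delta / 2) * y.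
  have -> : 1 - delta / 2 = (k%:R - (- delta / 2)) - beta.
    by rewrite /delta; lra.
  rewrite powRB ?n_neq0 ?implybT // ler_pdivrMr //.
  apply: le_trans (powR_le_Phi eta_gt0 k_gt0 n_gt0) _.
  by rewrite -mulrA ler_pM2l ?omega_const_gt0 // -ler_pdivrMr.
have -> : n%:R = (n%:R `^ (1 - delta / 2)) `^ (1 - delta / 2)^-1 :> R.
  by rewrite -powRrM divff ?gt_eqF // powRr1.
apply: ge0_ler_powR; rewrite ?nnegrE ?powR_ge0 ?invr_ge0 ?(ltW D'_gt0) //.
exact: le_trans (powR_ge0 _ _) leA.
Qed.

Theorem theorem3 (R : realType) :
  exists (C : R -> R) (q : nat -> R) (x0 : R -> nat -> R),
    [/\ forall delta : R, 0 < C delta,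
        forall k : nat, 0 < q k
      & forall (k : nat) (beta : R), (1 <= k)%N ->
        let delta := beta - (k%:R - 1) in
        delta < 0 ->
        forall eps x y : R, 0 < eps -> 0 < x -> 0 < y ->
        let alpha := y / x in
        0 < alpha < 1 ->
        x0 beta k <= x ->
        (phi_count (fun n => (Phi k n)%:R) beta x y)%:R <=
          C delta * (x `^ (2^-1 + (1 - delta) * eps)
                     * y `^ ((2 * (1 - delta))^-1 - eps)
                     * expR (- Num.sqrt (q k * ln x * ln (ln x))))].
Proof.
exists (fun delta => omega_const (- delta / 2) `^ (1 - delta / 2)^-1).
exists (fun=> 1).
(* Chosen so that [ln x] passes the threshold of [sqrt_mulr_ln_le] for [g = saving delta]. *)
exists (fun beta k => expR (1 + 4 / saving (beta - (k%:R - 1)) ^+ 4)).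
split=> [delta||k beta k_gt0 delta d_lt0 eps x y eps_gt0 x_gt0 y_gt0].
- by rewrite powR_gt0 // omega_const_gt0.
- by move=> _; exact: ltr01.
move=> alpha /andP[_ alpha_lt1] le_x0.
set g := saving delta in le_x0; have g_gt0 : 0 < g := saving_gt0 d_lt0.
have A_gt0 := omega_const_gt0 (- delta / 2).
have leC : (phi_count (fun n => (Phi k n)%:R) beta x y)%:R <=
    (omega_const (- delta / 2) * y) `^ (1 - delta / 2)^-1.
  apply: phi_count_le => [|n n_gt0]; first exact: powR_ge0.
  exact: size_le_of_Phi_le.
apply: le_trans leC _.
rewrite powRM ?(ltW A_gt0) ?(ltW y_gt0) // ler_pM2l ?powR_gt0 //.
(* The constant has cancelled; taking logarithms leaves an inequality between exponents in [ln x]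
   and [ln y]. *)
rewrite /powR !gt_eqF // -!expRD ler_expR mul1r.
have lt_vu : ln y < ln x.
  by rewrite ltr_ln ?posrE // -[x]mul1r -ltr_pdivrMr.
have le_u : 1 + 4 / g ^+ 4 <= ln x by rewrite -ler_expR lnK.
set u := ln x in lt_vu le_u *; set v := ln y in lt_vu *.
have g4 : 0 <= 4 / g ^+ 4 by rewrite divr_ge0 ?exprn_ge0 // ltW.
have u_gt0 : 0 < u by lra.
have leS : Num.sqrt (u * ln u) <= g * u by apply: sqrt_mulr_ln_le => //; lra.
have D_gt0 : 0 < 1 - delta by lra.
have D'_gt0 : 0 < 1 - delta / 2 by lra.
(* The excess exponent of [y] over the target. Since [g + kappa = 1/2], the factor [x^(1/2)] pays
   for both [kappa * v] and the square root. *)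
set kappa := (1 - delta / 2)^-1 - (2 * (1 - delta))^-1.
have kappa_gt0 : 0 < kappa.
  by rewrite subr_gt0 ltf_pV2 ?posrE ?mulr_gt0 //; lra.
have gE : g = 2^-1 - kappa.
  by rewrite /g /saving /kappa; field; rewrite !gt_eqF //; lra.
have le1 : kappa * v <= kappa * u by rewrite ler_pM2l // ltW.
(* The [eps] terms only help: [v < u <= (1 - delta) * u]. *)
have le2 : 0 <= eps * ((1 - delta) * u - v) by rewrite mulr_ge0 ?ltW //; nra.
have -> : (1 - delta / 2)^-1 = kappa + (2 * (1 - delta))^-1.
  by rewrite /kappa subrK.
rewrite gE in leS; nra.
Qed.
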